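(* Let $n\ge 1$ and let $\mathcal W$ be the Walsh algebra described in the context. For $p\in\{0,1,\ldots,2^n-1\}$ with binary representation $p=(p_0p_1\ldots p_{n-1})_2$, put $$\widehat e_p=\frac1{2^n}\prod_{k=0}^{n-1}\left[\widehat 1+(-1)^{p_k}\widehat u_k\right].$$ Then $\widehat e_0,\ldots,\widehat e_{2^n-1}$ are $2^n$ orthogonal idempotents in $\mathcal W$: $\widehat e_p\widehat e_p=\widehat e_p$ and $\widehat e_p\widehat e_q=\widehat 0$ for $p\ne q$.
   Context: The Walsh algebra is $\mathcal W=U_0\otimes U_1\otimes\cdots\otimes U_{n-1}$, the tensor product over $\mathbb R$ (called ''direct product'' in the paper) of $n$ two-dimensional commutative associative unital real algebras $U_k$ with bases $\{\widehat 1_k,\widehat u_k\}$, where $\widehat 1_k$ is the unit and $\widehat u_k^2=\widehat 1_k$. It is commutative, associative, unital, of dimension $2^n$, with unit $\widehat 1$; $\widehat u_k$ is identified with its image in $\mathcal W$, so $\widehat u_k^2=\widehat 1$. *)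

(* Defs.v *)
From HB Require Import structures.
From mathcomp Require Import all_boot all_order all_algebra.
From mathcomp Require Import reals.

Set Implicit Arguments.
Unset Strict Implicit.
Unset Printing Implicit Defensive.

Import GRing.Theory.
Local Open Scope ring_scope.

(* [dfwith x y] is the family x with its i-th component replaced by y : U i. *)
Definition multilinear (R : pzRingType) (I : eqType) (U : I -> lmodType R)
    (V : lmodType R) (f : (forall i, U i) -> V) : Prop :=
  forall (x : forall i, U i) (i : I), linear (fun y : U i => f (dfwith x y)).

(* Universal property of the tensor product: [tens x] is the pure tensor of
   the family x. *)
Definition is_tensor_product (R : pzRingType) (I : eqType)
    (U : I -> lmodType R) (W : lmodType R) (tens : (forall i, U i) -> W)
    : Prop :=
  multilinear tens /\
  forall (V : lmodType R) (f : (forall i, U i) -> V), multilinear f ->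
    exists2 g : {linear W -> V}, (forall x, g (tens x) = f x)
      & forall h : {linear W -> V}, (forall x, h (tens x) = f x) -> h =1 g.

Record is_tensor_algebra (R : comNzRingType) (I : eqType)
    (U : I -> algType R) (W : algType R) (tens : (forall i, U i) -> W)
    : Prop := IsTensorAlgebra {
  tensor_algebra_product : is_tensor_product tens;
  tensor_algebra1 : tens (fun i => 1) = 1;
  tensor_algebraM : forall x y : forall i, U i,
    tens (fun i => x i * y i) = tens x * tens y }.

(* The image of U k in the tensor product: 1 (x) .. (x) y (x) .. (x) 1, with
   y in position k. *)
Definition tensor_inj (R : comNzRingType) (I : eqType) (U : I -> algType R)
    (W : algType R) (tens : (forall i, U i) -> W) (k : I) (y : U k) : W :=
  tens (dfwith (fun i => 1 : U i) y).
Arguments tensor_inj {R I U W} tens k y.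

Definition is_basis2 (R : pzRingType) (V : lmodType R) (a b : V) : Prop :=
  forall x : V, exists! c : R * R, x = c.1 *: a + c.2 *: b.

Record is_walsh_algebra (R : realType) (n : nat) (U : 'I_n -> comAlgType R)
    (u : forall k, U k) (W : comAlgType R) (tens : (forall k, U k) -> W)
    : Prop := IsWalshAlgebra {
  walsh_basis : forall k, is_basis2 1 (u k);
  walsh_sqr : forall k, u k * u k = 1;
  walsh_tensor : is_tensor_algebra tens }.

(* (p_0 p_1 ... p_(n-1))_2 is read positionally, so p_0 is the most
   significant digit. *)
Definition bindigit (n p k : nat) : nat :=
  ((p %/ 2 ^ (n - k.+1)) %% 2)%N.

Lemma bindigitE (n p : nat) : (p < 2 ^ n)%N ->
  p = (\sum_(k < n) bindigit n p k * 2 ^ (n - k.+1))%N.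
Proof.
elim: n p => [|n IHn] p; first by rewrite big_ord0; case: p.
rewrite expnSr => ltp.
rewrite big_ord_recr /= /bindigit subnn expn0 divn1 muln1.
rewrite {1}(divn_eq p 2) {1}(IHn (p %/ 2)%N) ?ltn_divLR // big_distrl /=.
congr (_ + _)%N; apply: eq_bigr => k _.
by rewrite /bindigit subSn // expnS -divnMA -mulnA (mulnC 2%N).
Qed.

Definition walsh_idem (R : realType) (n : nat) (U : 'I_n -> comAlgType R)
    (u : forall k, U k) (W : comAlgType R) (tens : (forall k, U k) -> W)
    (p : 'I_(2 ^ n)) : W :=
  (2 ^+ n)^-1 *:
    \prod_(k < n) (1 + (-1) ^+ bindigit n p k *: tensor_inj tens k (u k)).

(* Main.v *)
Require Import Defs.
From HB Require Import structures.
From mathcomp Require Import all_boot all_order all_algebra.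
From mathcomp Require Import boolp reals.

Set Implicit Arguments.
Unset Strict Implicit.
Unset Printing Implicit Defensive.

Import GRing.Theory Num.Theory.
Local Open Scope ring_scope.

(** Write [w k] for the image of [u k] in [W] and [s k] for the sign of the
    k-th digit of [p].  As [w k * w k = 1], a factor [1 + s k *: w k] is twice
    an idempotent, and the factors of opposite signs annihilate each other
    ([mul_sign_factor]).  [W] being commutative, the product of two of the [e]
    can be taken factor by factor; distinct indices have a distinct digit,
    which yields a zero factor.  This gives idempotence and orthogonality from
    commutativity and the relations [w k * w k = 1] alone.

    These relations do not exclude that some [e p] vanish or coincide, and
    this is where the universal property of the tensor product comes in.
    The linear forms on the [U k] sending [1] to [1] and [u k] to [s k]
    multiply to a multilinear form, hence induce a linear form on [W]
    ([tensor_linear_form]).  As [e p] is, up to the factor [2 ^- n], the pure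
    tensor of the [1 + s k *: u k] ([prod_tensor_inj]), this form takes on it
    the value [2 ^- n] times the product of the [1 + s k * s k = 2], that is
    [1].  So [e p] is nonzero, and [e p = e q] with [p != q] is impossible, as
    it would give [e p = e p * e q = 0]. *)

(** * Sign factors *)

Lemma bindigit_inj (n p q : nat) : (p < 2 ^ n)%N -> (q < 2 ^ n)%N ->
  (forall k : 'I_n, bindigit n p k = bindigit n q k) -> p = q.
Proof.
move=> ltp ltq eqd; rewrite (bindigitE ltp) (bindigitE ltq).
by apply: eq_bigr => k _; rewrite eqd.
Qed.

Lemma bindigit_bool (n p k : nat) : exists b : bool, bindigit n p k = b.
Proof. by exists (odd (p %/ 2 ^ (n - k.+1))); rewrite /bindigit modn2. Qed.

Lemma mul_sign_factor (R : comNzRingType) (W : comAlgType R) (w : W)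
    (a b : bool) : w * w = 1 ->
  (1 + (-1) ^+ a *: w) * (1 + (-1) ^+ b *: w)
    = if a == b then 2 *: (1 + (-1) ^+ a *: w) else 0.
Proof.
move=> ww; rewrite mulrDl mul1r mulrDr mulr1 -scalerAl -scalerAr ww scalerA.
have [->|ab] := eqVneq a b.
  by rewrite -expr2 sqrr_sign scale1r [_ *: w + 1]addrC scaler_nat mulr2n.
have -> : a = ~~ b by case: a b ab => [] [].
by rewrite signrN mulNr -expr2 sqrr_sign !scaleNr scale1r addrA addrK
  subrr.
Qed.

(** * Tensor products of algebras *)

Section Tensor.

Context {R : comNzRingType} {n : nat} {U : 'I_n -> algType R} {W : algType R}.
Context {tens : (forall k, U k) -> W} (tensW : is_tensor_algebra tens).

Lemma eq_tens (x y : forall k, U k) : (forall k, x k = y k) ->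
  tens x = tens y.
Proof. by move=> xy; congr tens; apply: functional_extensionality_dep. Qed.

Lemma tensor_inj1 (k : 'I_n) : tensor_inj tens k 1 = 1.
Proof.
rewrite -(tensor_algebra1 tensW); apply: eq_tens => i.
by have [<-|ki] := eqVneq k i; rewrite ?dfwith_in ?dfwith_out.
Qed.

Lemma tensor_injM (k : 'I_n) (y z : U k) :
  tensor_inj tens k (y * z) = tensor_inj tens k y * tensor_inj tens k z.
Proof.
rewrite -(tensor_algebraM tensW); apply: eq_tens => i.
by have [<-|ki] := eqVneq k i; rewrite ?dfwith_in ?dfwith_out ?mulr1.
Qed.

Lemma tensor_inj_linear (k : 'I_n) : linear (tensor_inj tens k).
Proof. exact: (tensor_algebra_product tensW).1. Qed.

Lemma tens_prod (I : Type) (r : seq I) (x : I -> forall k, U k) :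
  \prod_(j <- r) tens (x j) = tens (fun k => \prod_(j <- r) x j k).
Proof.
elim: r => [|j r IHr].
  by rewrite big_nil -(tensor_algebra1 tensW); apply: eq_tens => k;
    rewrite big_nil.
rewrite big_cons IHr -(tensor_algebraM tensW); apply: eq_tens => k.
by rewrite big_cons.
Qed.

(** Pure tensors multiply componentwise, and in position [i] every factor but
    the i-th contributes [1]. *)
Lemma prod_tensor_inj (y : forall k, U k) :
  \prod_(k < n) tensor_inj tens k (y k) = tens y.
Proof.
rewrite tens_prod; apply: eq_tens => i.
rewrite (@big_only1 _ _ _ _ i) ?dfwith_in // => j ji _.
by rewrite dfwith_out.
Qed.

(** The product of the forms [phi k] is multilinear since the i-th component
    of its argument only enters the factor of index [i]. *)
Lemma tensor_linear_form (phi : forall k, {linear U k -> R^o}) :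
  exists g : {linear W -> R^o},
    forall x, g (tens x) = \prod_(k < n) (phi k (x k) : R).
Proof.
have multi : multilinear (V := R^o)
    (fun x : forall k, U k => \prod_(k < n) (phi k (x k) : R)).
  move=> x i a y z /=.
  have split_i t : \prod_(k < n) (phi k (dfwith x t k) : R)
      = (phi i t : R) * \prod_(k < n | k != i) (phi k (x k) : R).
    rewrite (bigD1 i) //= dfwith_in; congr (_ * _); apply: eq_bigr => k ki.
    by rewrite dfwith_out // eq_sym.
  by rewrite !split_i linearP mulrDl [in RHS]/GRing.scale /= mulrA.
by have [g gE _] := (tensor_algebra_product tensW).2 _ _ multi; exists g.
Qed.

End Tensor.

(** The form is [c |-> c.1 + c.2 * s] in the coordinates [c] on the basis;
    the uniqueness of the coordinates makes it linear. *)
Lemma basis2_linear_form (R : comNzRingType) (V : lmodType R) (a b : V)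
    (s : R) : is_basis2 a b ->
  exists phi : {linear V -> R^o}, phi a = 1 /\ phi b = s.
Proof.
move=> ab; pose c x := projT1 (cid (ab x)).
have cE x : x = (c x).1 *: a + (c x).2 *: b := (projT2 (cid (ab x))).1.
have c_uniq x d : x = d.1 *: a + d.2 *: b -> c x = d :=
  (projT2 (cid (ab x))).2 d.
pose f x : R^o := (c x).1 + (c x).2 * s.
have f_lin : linear f.
  move=> k x y; rewrite /f (c_uniq (k *: x + y)
    (k * (c x).1 + (c y).1, k * (c x).2 + (c y).2)) /=.
    by rewrite /GRing.scale /= mulrDr mulrDl mulrA addrACA.
  by rewrite {1}(cE x) {1}(cE y) scalerDr !scalerDl !scalerA addrACA.
pose phi : {linear V -> R^o} :=
  HB.pack f (GRing.isLinear.Build R V R^o *:%R f f_lin).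
exists phi; rewrite /phi /= /f (c_uniq a (1, 0)) ?(c_uniq b (0, 1)) /=.
- by rewrite mul0r addr0 mul1r add0r.
- by rewrite scale0r scale1r add0r.
by rewrite scale0r scale1r addr0.
Qed.

(** * The Walsh algebra *)

Section Walsh.

Context {R : realType} {n : nat} {U : 'I_n -> comAlgType R}.
Context {u : forall k, U k} {W : comAlgType R} {tens : (forall k, U k) -> W}.
Context (walshW : is_walsh_algebra u tens).

Let tensW := walsh_tensor walshW.
Let w (k : 'I_n) : W := tensor_inj tens k (u k).

Lemma tensor_inj_sqr (k : 'I_n) : w k * w k = 1.
Proof.
by rewrite -(tensor_injM tensW) (walsh_sqr walshW) (tensor_inj1 tensW).
Qed.

Lemma walsh_idemM (p q : 'I_(2 ^ n)) :
  walsh_idem u tens p * walsh_idem u tens q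
    = if p == q then walsh_idem u tens p else 0.
Proof.
rewrite /walsh_idem -scalerAl -scalerAr scalerA -big_split /=.
have factorM (k : 'I_n) :
    (1 + (-1) ^+ bindigit n p k *: w k) * (1 + (-1) ^+ bindigit n q k *: w k)
    = if bindigit n p k == bindigit n q k
      then 2 *: (1 + (-1) ^+ bindigit n p k *: w k) else 0.
  have [[a ->] [b ->]] := (bindigit_bool n p k, bindigit_bool n q k).
  by rewrite (mul_sign_factor _ _ (tensor_inj_sqr k)); case: a b => [] [].
rewrite (eq_bigr _ (fun k _ => factorM k)).
have [<-|pq] := eqVneq p q.
  under eq_bigr => k _ do rewrite eqxx.
  rewrite scaler_prodl card_ord scalerA mulfVK //.
  by rewrite expf_neq0 // pnatr_eq0.
have [k pqk] : exists k : 'I_n, bindigit n p k != bindigit n q k.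
  apply/existsP; apply: contraNT pq; rewrite negb_exists => /forallP eq_pq.
  apply/eqP/val_inj/(bindigit_inj (ltn_ord p) (ltn_ord q)) => k.
  by apply/eqP; rewrite -[_ == _]negbK.
by rewrite (bigD1 k) //= (negPf pqk) mul0r scaler0.
Qed.

(** The form tested is the character of [W] sending each [w k] to the sign
    [s k] that occurs in [e p]; it takes the value [1] on [e p]. *)
Lemma walsh_idem_neq0 (p : 'I_(2 ^ n)) : walsh_idem u tens p != 0.
Proof.
pose s (k : 'I_n) : R := (-1) ^+ bindigit n p k.
pose form (k : 'I_n) :=
  cid (basis2_linear_form (s k) (@walsh_basis _ _ _ _ _ _ walshW k)).
have [g gE] := tensor_linear_form tensW (fun k => projT1 (form k)).
have prodE : \prod_(k < n) (1 + s k *: w k) = tens (fun k => 1 + s k *: u k).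
  rewrite -(prod_tensor_inj tensW); apply: eq_bigr => k _.
  by rewrite addrC [in RHS]addrC
    (tensor_inj_linear tensW) (tensor_inj1 tensW).
suff g1 : g (walsh_idem u tens p) = 1.
  by apply: contra_eq_neq g1 => ->; rewrite linear0 eq_sym oner_neq0.
rewrite /walsh_idem linearZ prodE gE /=.
rewrite (eq_bigr (fun=> 2%R)) => [|k _].
  rewrite prodr_const card_ord.
  by rewrite [LHS]mulVf // expf_neq0 // pnatr_eq0.
have [phi1 phiu] := projT2 (form k).
have ss : s k *: (s k : R^o) = 1.
  by rewrite /GRing.scale /= -expr2 sqrr_sign.
by rewrite linearD linearZ phi1 phiu /= ss.
Qed.

End Walsh.

Theorem mainTheorem3 (R : realType) (n : nat) (n_ge1 : (1 <= n)%N)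
    (U : 'I_n -> comAlgType R) (u : forall k, U k)
    (W : comAlgType R) (tens : (forall k, U k) -> W)
    (walshW : is_walsh_algebra u tens) :
  let e := walsh_idem u tens in
  [/\ injective e,
      forall p, e p * e p = e p
    & forall p q, p != q -> e p * e q = 0].
Proof.
move=> e; have eM p q : e p * e q = if p == q then e p else 0.
  exact: walsh_idemM.
split=> [p q epq | p | p q /negPf pq]; rewrite ?eM ?eqxx ?pq //.
apply: contraNeq (walsh_idem_neq0 walshW p) => /negPf pq.
by have := eM p q; rewrite pq -epq eM eqxx => /eqP.
Qed.
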